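(* Let $n\ge 1$. Let $\mathcal{L}_1$ be the set of all real $n\times n$ lower triangular matrices whose diagonal entries are all $1$, let $\mathcal{U}_1$ be the set of all real $n\times n$ upper triangular matrices whose diagonal entries are all $1$, and let $\mathcal{D}$ be the set of all real invertible $n\times n$ diagonal matrices. Let $\mathcal{P}$ be the set of all real $n\times n$ matrices $A$ such that all leading principal minors of $A$ are invertible. Let $F:\mathcal{L}_1\times\mathcal{D}\times\mathcal{U}_1\to\mathrm{GL}(n,\mathbb{R})$ be the map $F(L,D,U)=LDU$. Then: (1) The map $F$ is an analytic diffeomorphism between $\mathcal{L}_1\times\mathcal{D}\times\mathcal{U}_1$ and $\mathcal{P}$. (2) Every matrix in $\mathcal{P}$ has a unique LDU factorization.
   Context: The leading principal minors of an $n\times n$ matrix $A$ are here the square matrices (not their determinants) obtained from $A$ by deleting the last $k$ rows and the last $k$ columns for some integer $0\le k\le n-1$; i.e. they are the upper left $j\times j$ blocks of $A$, $1\le j\le n$. An LDU factorization of $A$ is an expression $A=LDU$ with $L\in\mathcal{L}_1$, $D\in\mathcal{D}$, $U\in\mathcal{U}_1$. $\mathcal{L}_1$ and $\mathcal{U}_1$ are affine subspaces of the space of real $n\times n$ matrices, $\mathcal{D}$ is an open subset of the vector space of real diagonal matrices, and $\mathcal{P}$ is an open subset of the space of real $n\times n$ matrices, contained in the group $\mathrm{GL}(n,\mathbb{R})$ of invertible real $n\times n$ matrices. An analytic diffeomorphism is a bijection between real-analytic manifolds that is real-analytic with real-analytic inverse. *)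

(* Defs.v *)
From HB Require Import structures.
From mathcomp Require Import all_boot all_order all_fingroup all_algebra.
From mathcomp Require Import all_classical all_reals all_analysis.

Set Implicit Arguments.
Unset Strict Implicit.
Unset Printing Implicit Defensive.

Import Order.TTheory GRing.Theory Num.Theory.
Import numFieldNormedType.Exports.
Local Open Scope classical_set_scope.
Local Open Scope ring_scope.

(* R^d is [I -> R] for a finite type [I] with d elements. *)
Section Analytic.
Context {R : realType} {I : finType}.
Implicit Types (a x : I -> R) (c : {ffun I -> nat} -> R) (U : set (I -> R)).

Definition cube a (r : R) : set (I -> R) :=
  [set x | forall i, `|x i - a i| < r].

Definition cube_open U :=
  forall a, U a -> exists2 r : R, 0 < r & cube a r `<=` U.

(* The degree-k homogeneous part of the power series sum_alpha c_alpha h^alpha.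
   The multi-indices alpha with |alpha| = k have all their entries at most k,
   so they form a subset of the finite type {ffun I -> 'I_k.+1}. *)
Definition homogeneous_part c (h : I -> R) (k : nat) : R :=
  \sum_(alpha : {ffun I -> 'I_k.+1} | (\sum_i alpha i == k)%N)
     c [ffun i => nat_of_ord (alpha i)] * \prod_i h i ^+ alpha i.

(* [f] is, on a neighbourhood of [a], the sum of an absolutely convergent power
   series centred at [a]. *)
Definition analytic_at (f : (I -> R) -> R) a :=
  exists (c : {ffun I -> nat} -> R) (r : R), 0 < r /\
    forall x, cube a r x ->
      cvgn (series (homogeneous_part (fun alpha => `|c alpha|)
                                     (fun i => `|x i - a i|))) /\
      series (homogeneous_part c (fun i => x i - a i)) @ \oo --> f x.

End Analytic.

(* A real-analytic manifold given by one global chart: [coords] identifies S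
   with the open subset [set x | S (param x)] of R^I, and [param] is the inverse
   identification; their values elsewhere are irrelevant. *)
Record chart (R : realType) (T : Type) (S : set T) (I : finType) := Chart {
  coords : T -> I -> R;
  param : (I -> R) -> T;
  coordsK : forall p, S p -> param (coords p) = p;
  paramK : forall x, S (param x) -> coords (param x) = x;
  param_open : cube_open [set x | S (param x)] }.

Section AnalyticMaps.
Context {R : realType} {T T' : Type} {S : set T} {S' : set T'} {I I' : finType}.

Definition analytic_map (M : chart R S I) (M' : chart R S' I') (f : T -> T') :=
  (forall p, S p -> S' (f p)) /\
  forall p, S p -> forall j : I',
    analytic_at (fun x => coords M' (f (param M x)) j) (coords M p).

End AnalyticMaps.

Definition analytic_diffeomorphism (R : realType) (T T' : Type)
    (S : set T) (S' : set T') (I I' : finType)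
    (M : chart R S I) (M' : chart R S' I') (f : T -> T') :=
  [/\ set_bij S S' f, analytic_map M M' f &
      exists g : T' -> T,
        [/\ forall p, S p -> g (f p) = p,
            forall q, S' q -> f (g q) = q &
            analytic_map M' M g]].

Section ProductChart.
Context {R : realType} {T T' : Type} {S : set T} {S' : set T'} {I I' : finType}.
Variables (M : chart R S I) (M' : chart R S' I').

Let pcoords (p : T * T') (k : I + I') : R :=
  match k with inl i => coords M p.1 i | inr j => coords M' p.2 j end.
Let pparam (x : I + I' -> R) : T * T' :=
  (param M (fun i => x (inl i)), param M' (fun j => x (inr j))).

Let pcoordsK p : (S `*` S') p -> pparam (pcoords p) = p.
Proof.
case: p => p q [/= Sp Sq]; rewrite /pparam /pcoords /=.
by congr pair; [exact: (coordsK M Sp)|exact: (coordsK M' Sq)].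
Qed.

Let pparamK x : (S `*` S') (pparam x) -> pcoords (pparam x) = x.
Proof.
move=> [/= /paramK Ex /paramK Ey]; apply/funext => -[i|j] /=.
  by rewrite Ex.
by rewrite Ey.
Qed.

Let pparam_open : cube_open [set x | (S `*` S') (pparam x)].
Proof.
move=> a [/= /(param_open (c := M)) [r r0 rS] /(param_open (c := M')) [s s0 sS]].
exists (Num.min r s); first by rewrite lt_min r0.
move=> x xa; split => /=.
  by apply: rS => i; have := xa (inl i); rewrite lt_min => /andP[].
by apply: sS => j; have := xa (inr j); rewrite lt_min => /andP[].
Qed.

Definition prod_chart : chart R (S `*` S') (I + I')%type :=
  Chart pcoordsK pparamK pparam_open.

End ProductChart.

(* The manifold structure of a relatively open subset S of an affine space of
   matrices, where [Q] marks the free entries and the other entries are those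
   of [B]: the free entries are the coordinates. *)
Section MatrixChart.
Context {R : realType} {n : nat}.
Variables (Q : pred ('I_n * 'I_n)) (B : 'M[R]_n).

Definition affine_mx : set 'M[R]_n :=
  [set A | forall i j, ~~ Q (i, j) -> A i j = B i j].

Definition mx_coords (A : 'M[R]_n) (s : {ij | Q ij}) : R :=
  A (val s).1 (val s).2.

Definition mx_param (x : {ij | Q ij} -> R) : 'M[R]_n :=
  \matrix_(i, j) if insub (i, j) is Some s then x s else B i j.

Lemma mx_param_affine x : affine_mx (mx_param x).
Proof. by move=> i j nQ; rewrite mxE insubN. Qed.

Lemma mx_coordsK A : affine_mx A -> mx_param (mx_coords A) = A.
Proof.
move=> affA; apply/matrixP => i j; rewrite mxE.
by case: insubP => [s _ Es|/affA //]; rewrite /mx_coords Es.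
Qed.

Lemma mx_paramK x : mx_coords (mx_param x) = x.
Proof.
by apply/funext => s; rewrite /mx_coords mxE -surjective_pairing valK.
Qed.

Variables (S U : set 'M[R]_n) (openU : open U) (SE : S = affine_mx `&` U).

Let mx_coordsK_on A : S A -> mx_param (mx_coords A) = A.
Proof. by rewrite SE => -[/mx_coordsK]. Qed.

Let mx_param_open : cube_open [set x | S (mx_param x)].
Proof.
move=> a Sa; have [_ Ua] : (affine_mx `&` U) (mx_param a) by rewrite -SE.
have /nbhs_ballP[r /= r0 rU] : nbhs (mx_param a) U by exact: open_nbhs_nbhs.
exists r => // x xa /=; rewrite SE; split; first exact: mx_param_affine.
apply: rU; split => // i j; rewrite !mxE; case: insubP => [s _ _|_].
  by rewrite /ball /= distrC; exact: xa.
exact: ballxx.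
Qed.

Definition mx_chart : chart R S {ij | Q ij} :=
  Chart mx_coordsK_on (fun x _ => mx_paramK x) mx_param_open.

End MatrixChart.

Section OpenMatrices.
Context {R : realType} {n : nat}.

Let cont_mxsub_det m (f : 'I_m -> 'I_n) :
  continuous (fun A : 'M[R]_n => \det (mxsub f f A)).
Proof.
have cprod (s : {perm 'I_m}) :
    continuous (fun A : 'M[R]_n => \prod_i mxsub f f A i (s i) : R^o).
  apply: (@continuous_big R^o _ *%R 1 _ (@mul_continuous R)) => i _.
  by under eq_fun do rewrite mxE; exact: coord_continuous.
apply: (@continuous_big R^o _ +%R 0 _ (@add_continuous R^o)) => s _ A.
exact: (@cvgM R _ _ _ (cst _) _ _ _ (cvg_cst _) (cprod s A)).
Qed.

Lemma open_mxsub_unit m (f : 'I_m -> 'I_n) :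
  open [set A : 'M[R]_n | mxsub f f A \in unitmx].
Proof.
rewrite (_ : mkset _ = (fun A : 'M[R]_n => \det (mxsub f f A)) @^-1` [set x | x != 0]).
  by apply: open_comp => [A _|]; [exact: cont_mxsub_det|exact: open_neq].
by apply/seteqP; split => A /=; rewrite unitmxE unitfE.
Qed.

Lemma open_unitmx : open [set A : 'M[R]_n | A \in unitmx].
Proof.
have := @open_mxsub_unit n id.
by congr open; apply/seteqP; split => A /=; rewrite mxsub_id.
Qed.

End OpenMatrices.

Section LDU.
Variables (R : realType) (n : nat).

Definition unit_lower : set 'M[R]_n :=
  [set L | is_trig_mx L /\ forall i, L i i = 1].

Definition unit_upper : set 'M[R]_n :=
  [set U | is_trig_mx U^T /\ forall i, U i i = 1].

Definition invertible_diag : set 'M[R]_n :=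
  [set D | is_diag_mx D /\ D \in unitmx].

(* The upper left j x j block itself, not its determinant. *)
Definition leading_minor (A : 'M[R]_n) (j : nat) (jn : (j <= n)%N) : 'M[R]_j :=
  mxsub (widen_ord jn) (widen_ord jn) A.

Definition minors_invertible : set 'M[R]_n :=
  [set A | forall (j : nat) (jn : (j <= n)%N), (0 < j)%N ->
     leading_minor A jn \in unitmx].

Definition LDU_mul (p : 'M[R]_n * 'M[R]_n * 'M[R]_n) : 'M[R]_n :=
  p.1.1 *m p.1.2 *m p.2.

Definition LDU_dom : set ('M[R]_n * 'M[R]_n * 'M[R]_n) :=
  unit_lower `*` invertible_diag `*` unit_upper.

Definition LDU_factorization (A : 'M[R]_n) p := LDU_dom p /\ A = LDU_mul p.

Lemma det_unit_lower L : unit_lower L -> \det L = 1.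
Proof. by case=> tL dL; rewrite det_trig// big1. Qed.

(* The product map takes its values in GL(n, R). *)
Lemma LDU_mul_unit p : LDU_dom p -> LDU_mul p \in unitmx.
Proof.
case: p => [[L D] U] [[/= lowL [_ uD]] [tU dU]].
have detU : \det U = 1.
  by rewrite -det_tr det_unit_lower//; split => // i; rewrite mxE.
by rewrite /LDU_mul /= !unitmx_mul uD !unitmxE detU (det_unit_lower lowL) unitr1.
Qed.

Definition lower_pos : pred ('I_n * 'I_n) :=
  [pred ij : 'I_n * 'I_n | (ij.2 < ij.1)%N].
Definition upper_pos : pred ('I_n * 'I_n) :=
  [pred ij : 'I_n * 'I_n | (ij.1 < ij.2)%N].
Definition diag_pos : pred ('I_n * 'I_n) :=
  [pred ij : 'I_n * 'I_n | ij.1 == ij.2].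

Let unit_lowerE : unit_lower = affine_mx lower_pos 1%:M `&` setT.
Proof.
rewrite setIT; apply/seteqP; split => [L [/is_trig_mxP tL dL] i j /=|L affL].
  rewrite -leqNgt leq_eqVlt mxE -val_eqE /= => /predU1P[/val_inj ->|ij].
    by rewrite dL eqxx.
  by rewrite tL// ltn_eqF.
split=> [|i]; last by rewrite affL ?mxE ?eqxx //= -leqNgt.
apply/is_trig_mxP => i j ij; rewrite affL /=; last by rewrite -leqNgt ltnW.
by rewrite mxE -val_eqE /= ltn_eqF.
Qed.

Let unit_upperE : unit_upper = affine_mx upper_pos 1%:M `&` setT.
Proof.
rewrite setIT; apply/seteqP; split => [U [/is_trig_mxP tU dU] i j /=|U affU].
  rewrite -leqNgt leq_eqVlt mxE -val_eqE /= => /predU1P[/val_inj ->|ij].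
    by rewrite dU eqxx.
  by have := tU j i ij; rewrite mxE => ->; rewrite gtn_eqF.
split=> [|i]; last by rewrite affU ?mxE ?eqxx //= -leqNgt.
apply/is_trig_mxP => i j ij.
rewrite mxE affU /=; last by rewrite -leqNgt ltnW.
by rewrite mxE -val_eqE /= gtn_eqF.
Qed.

Let invertible_diagE :
  invertible_diag = affine_mx diag_pos 0 `&` [set D | D \in unitmx].
Proof.
apply/seteqP; split => D [dD uD]; split => //.
  by move=> i j /= ij; rewrite mxE; move/is_diag_mxP: dD; apply.
by apply/is_diag_mxP => i j ij; rewrite dD ?mxE.
Qed.

Let minors_invertibleE :
  minors_invertible = affine_mx xpredT 0 `&` minors_invertible.
Proof. by apply/seteqP; split => [A PA|A []]. Qed.

Lemma open_minors_invertible : open minors_invertible.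
Proof.
have -> : minors_invertible =
    [set A | forall k : 'I_n, leading_minor A (ltn_ord k) \in unitmx].
  apply/seteqP; split => [A PA k|A PA [//|j] jn _]; first exact: PA.
  by rewrite (bool_irrelevance jn (ltn_ord (Ordinal jn))); exact: (PA (Ordinal jn)).
rewrite openE => A PA; rewrite /interior /=.
apply: (@filter_forall _ _ (fun k : 'I_n =>
  [set A | leading_minor A (ltn_ord k) \in unitmx]) (nbhs A)) => k.
by apply: open_nbhs_nbhs; split; [exact: open_mxsub_unit|exact: PA].
Qed.

Definition lower_chart : chart R unit_lower {ij | lower_pos ij} :=
  mx_chart openT unit_lowerE.
Definition upper_chart : chart R unit_upper {ij | upper_pos ij} :=
  mx_chart openT unit_upperE.
Definition diag_chart : chart R invertible_diag {ij | diag_pos ij} :=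
  mx_chart open_unitmx invertible_diagE.
Definition minors_chart : chart R minors_invertible {ij | xpredT ij} :=
  mx_chart open_minors_invertible minors_invertibleE.

Definition LDU_chart := prod_chart (prod_chart lower_chart diag_chart) upper_chart.

End LDU.

(* Main.v *)
(* Gaussian elimination with the (0, 0) pivot: A lies in P iff its pivot is
   nonzero and its Schur complement lies in P for n - 1, and the LDU factors of
   A are obtained from those of the Schur complement by bordering. By induction
   on n this inverts F on P using only sums, products and inverses of nonzero
   pivots. So both directions are analytic once analytic functions are known to
   be closed under these operations. For 1/f, the coefficients are determined
   recursively; on a smaller polydisc, where the nonconstant part of f is
   dominated by half of |f(a)|, the resulting power series converges absolutely,
   and its Cauchy product with that of f is 1. *)
Require Import Defs.
From mathcomp Require Import all_boot all_order all_fingroup all_algebra.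
From mathcomp Require Import all_classical all_reals all_analysis.
From mathcomp Require Import ring lra.

Set Implicit Arguments.
Unset Strict Implicit.
Unset Printing Implicit Defensive.

Import Order.TTheory GRing.Theory Num.Theory.
Import numFieldNormedType.Exports.
Local Open Scope classical_set_scope.
Local Open Scope ring_scope.

(** * Power series *)

Section CauchyProduct.
Context {R : realType}.
Implicit Types a b A B : R ^nat.

(** Both sides run over the pairs with [i + j < N], once by antidiagonals and once by rows; the
    substitution is [j = k - i]. *)
Lemma sum_triangle (F : nat -> nat -> R) N :
  \sum_(0 <= k < N) \sum_(0 <= i < k.+1) F i (k - i)%N =
  \sum_(0 <= i < N) \sum_(0 <= j < N | (i + j < N)%N) F i j.
Proof.
transitivity (\sum_(0 <= k < N) \sum_(0 <= i < N | (i <= k)%N) F i (k - i)%N).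
  by apply: eq_big_nat => k /andP[_ kN]; rewrite (big_nat_widen _ _ N).
rewrite (exchange_big_dep_nat xpredT)//=; apply: eq_big_nat => i /andP[_ iN].
transitivity (\sum_(i <= k < N) F i (k - i)%N).
  by rewrite [RHS](big_nat_widenl _ 0%N) //.
rewrite -[in LHS](add0n i) big_addn (big_nat_widen _ _ N) ?leq_subr//.
apply: eq_big => [j|j _]; last by rewrite addnK.
by rewrite /= ltn_subRL.
Qed.

(** The triangle lies in the square of side [N], and the omitted terms are nonnegative. *)
Lemma ler_sum_triangle (A B : R ^nat) N :
  (forall k, 0 <= A k) -> (forall k, 0 <= B k) ->
  \sum_(0 <= k < N) \sum_(0 <= i < k.+1) A i * B (k - i)%N <=
  (\sum_(0 <= i < N) A i) * (\sum_(0 <= j < N) B j).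
Proof.
move=> A0 B0; rewrite (sum_triangle (fun i j => A i * B j)) mulr_suml.
apply: ler_sum => i _; rewrite mulr_sumr big_mkcond/=.
by apply: ler_sum => j _; case: ifP => // _; rewrite mulr_ge0.
Qed.

Lemma sum_ge0_bounded_cvg A M : (forall k, 0 <= A k) ->
  (forall N, \sum_(0 <= k < N) A k <= M) -> cvgn (series A).
Proof.
move=> A0 AM; apply: nondecreasing_is_cvgn.
  by apply/nondecreasing_seqP => n; rewrite /series/= big_nat_recr//= lerDl.
by exists M => _ [N _ <-]; exact: AM.
Qed.

Lemma dominated_cvg_series a A M : (forall k, `|a k| <= A k) ->
  (forall N, \sum_(0 <= k < N) A k <= M) -> cvgn (series a).
Proof.
move=> aA AM; apply: (@normed_cvg R R^o).
apply: (@sum_ge0_bounded_cvg _ M) => [k|N]; first exact: normr_ge0.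
by rewrite /=; apply: le_trans (AM N); apply: ler_sum => i _; exact: aA.
Qed.

(** The gap between a partial sum of the Cauchy product and the product of the partial sums is
    dominated by the same gap for the majorants [A] and [B]. There, monotonicity forces both
    sequences to have the same limit. *)
Lemma cvg_cauchy_product a b A B MA MB (la lb : R) :
  (forall k, `|a k| <= A k) -> (forall k, `|b k| <= B k) ->
  (forall N, \sum_(0 <= k < N) A k <= MA) ->
  (forall N, \sum_(0 <= k < N) B k <= MB) ->
  series a @ \oo --> la -> series b @ \oo --> lb ->
  series (fun k => \sum_(0 <= i < k.+1) a i * b (k - i)%N) @ \oo --> la * lb.
Proof.
move=> aA bB AM BM al bl.
have A0 k : 0 <= A k by apply: le_trans (aA k).
have B0 k : 0 <= B k by apply: le_trans (bB k).
pose C := fun k => \sum_(0 <= i < k.+1) A i * B (k - i)%N.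
have C0 k : 0 <= C k by apply: sumr_ge0 => i _; rewrite mulr_ge0.
have sum0 (u : R ^nat) N : (forall k, 0 <= u k) -> 0 <= \sum_(0 <= k < N) u k.
  by move=> u0; rewrite sumr_ge0.
have cA := sum_ge0_bounded_cvg A0 AM; have cB := sum_ge0_bounded_cvg B0 BM.
have cC : cvgn (series C).
  apply: (@sum_ge0_bounded_cvg _ (MA * MB)) => // N.
  apply: le_trans (ler_sum_triangle _ A0 B0) _.
  by apply: ler_pM; rewrite ?sum0.
have AB : series A n * series B n @[n --> \oo] -->
    limn (series A) * limn (series B) by apply: cvgM.
(* The partial sums satisfy [C_N <= A_N * B_N <= C_(2N)]. *)
have CAB : limn (series C) = limn (series A) * limn (series B).
  apply/eqP; rewrite eq_le; apply/andP; split.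
    rewrite -(cvg_lim _ AB)//; apply: ler_lim => //.
      by apply/cvg_ex; eexists; exact: AB.
    by apply: nearW => N; exact: ler_sum_triangle.
  rewrite -(cvg_lim _ AB)//; apply: limr_le.
    by apply/cvg_ex; eexists; exact: AB.
  apply: nearW => N; apply: le_trans (nondecreasing_cvgn_le _ cC (N + N)); last first.
    by apply/nondecreasing_seqP => n; rewrite /series/= big_nat_recr//= lerDl.
  (* The square of side [N] lies in the triangle [i + j < N + N]; the remaining rows and columns are
     dropped. *)
  rewrite /series/= (sum_triangle (fun i j => A i * B j)) mulr_suml.
  rewrite [leRHS](big_cat_nat (n := N)) ?leq_addr//= -[leLHS]addr0 lerD//; last first.
    by do 2 (apply: sumr_ge0 => ? _); rewrite mulr_ge0.
  apply: ler_sum_nat => i /andP[_ iN].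
  rewrite mulr_sumr [leRHS]big_mkcond/= [leRHS](big_cat_nat (n := N)) ?leq_addr//=.
  rewrite -[leLHS]addr0 lerD//; last first.
    by apply: sumr_ge0 => ? _; case: ifP => // _; rewrite mulr_ge0.
  apply: ler_sum_nat => j /andP[_ jN].
  by rewrite ifT// -addnS leq_add// ltnW.
set c := fun k => _.
suff dcv : series c n - series a n * series b n @[n --> \oo] --> 0.
  have -> : series c = fun n => (series c n - series a n * series b n) +
      series a n * series b n by apply/funext => n; rewrite subrK.
  by rewrite -[la * lb]add0r; apply: cvgD => //; apply: cvgM.
apply: norm_cvg0.
apply: (@squeeze_cvgr _ _ _ _ (fun=> 0)
  (fun n => series A n * series B n - series C n)); last 2 first.
- exact: cvg_cst.
- rewrite -(subrr (limn (series A) * limn (series B))) -{2}CAB.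
  by apply: cvgB.
(* In both gaps the triangle cancels against the square, leaving the pairs with [i + j >= N], which
   are compared term by term. *)
apply: nearW => N; rewrite normr_ge0/= distrC.
rewrite /series/= /c /C (sum_triangle (fun i j => A i * B j)).
rewrite (sum_triangle (fun i j => a i * b j)) !mulr_suml -!sumrB.
apply: le_trans (ler_norm_sum _ _ _) _; apply: ler_sum => i _.
rewrite !mulr_sumr -(big_mkcond xpredT) -(big_mkcond xpredT)/=.
rewrite (bigID (fun j => i + j < N)%N) addrAC subrr add0r.
rewrite [leRHS](_ : _ = \sum_(0 <= j < N | ~~ (i + j < N)%N) A i * B j); last first.
  by rewrite (bigID (fun j => i + j < N)%N) addrAC subrr add0r.
apply: le_trans (ler_norm_sum _ _ _) _; apply: ler_sum => j _.
by rewrite normrM ler_pM.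
Qed.

End CauchyProduct.

(** * Homogeneous polynomials as lists of terms *)

Section Terms.
Context {R : realType} {I : finType}.

(* A polynomial is an unreduced list of terms, so that the sum of the absolute
   values of its coefficients is multiplicative. *)
Definition terms := seq (R * {ffun I -> nat}).
Implicit Types (p q : terms) (h : I -> R) (al : {ffun I -> nat}).

Definition monomial al h : R := \prod_i h i ^+ al i.
Definition teval p h : R := \sum_(t <- p) t.1 * monomial t.2 h.
Definition tnorm p : R := \sum_(t <- p) `|t.1|.
Definition homog (k : nat) p :=
  all (fun t : R * {ffun I -> nat} => \sum_i t.2 i == k)%N p.
Definition tscale (c : R) p : terms := [seq (c * t.1, t.2) | t <- p].
Definition tmul p q : terms :=
  [seq (s.1 * t.1, [ffun i => (s.2 : {ffun I -> nat}) i + (t.2 : {ffun I -> nat}) i]%N)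
    | s <- p, t <- q].

Lemma teval_scale c p h : teval (tscale c p) h = c * teval p h.
Proof. by rewrite /teval big_map mulr_sumr; apply: eq_bigr => t _; rewrite mulrA. Qed.

Lemma tnorm_scale c p : tnorm (tscale c p) = `|c| * tnorm p.
Proof. by rewrite /tnorm big_map mulr_sumr; apply: eq_bigr => t _; rewrite normrM. Qed.

Lemma homog_scale c k p : homog k p -> homog k (tscale c p).
Proof. by rewrite /homog all_map. Qed.

Lemma teval_cat p q h : teval (p ++ q) h = teval p h + teval q h.
Proof. exact: big_cat. Qed.

Lemma tnorm_cat p q : tnorm (p ++ q) = tnorm p + tnorm q.
Proof. exact: big_cat. Qed.

Lemma teval_mul p q h : teval (tmul p q) h = teval p h * teval q h.
Proof.
rewrite /teval big_allpairs_dep mulr_suml; apply: eq_bigr => s _.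
rewrite mulr_sumr; apply: eq_bigr => t _ /=; rewrite mulrACA; congr (_ * _).
by rewrite -big_split; apply: eq_bigr => i _; rewrite ffunE exprD.
Qed.

Lemma tnorm_mul p q : tnorm (tmul p q) = tnorm p * tnorm q.
Proof.
rewrite /tnorm big_allpairs_dep mulr_suml; apply: eq_bigr => s _.
by rewrite mulr_sumr; apply: eq_bigr => t _; rewrite normrM.
Qed.

Lemma homog_mul k l p q : homog k p -> homog l q -> homog (k + l) (tmul p q).
Proof.
move=> /allP pk /allP ql; apply/allP => _ /allpairsP[[s t]] /= [sp tq ->] /=.
under eq_bigr do rewrite ffunE.
by rewrite big_split/= (eqP (pk _ sp)) (eqP (ql _ tq)).
Qed.

Lemma tnorm_ge0 p : 0 <= tnorm p.
Proof. exact: sumr_ge0. Qed.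

Lemma monomial_le al h (s : R) : (forall i, `|h i| <= s) ->
  `|monomial al h| <= s ^+ (\sum_i al i)%N.
Proof.
move=> hs; rewrite normr_prod -prodrXr; apply: ler_prod => i _.
by rewrite normr_ge0 normrX lerXn2r ?nnegrE// (le_trans _ (hs i)).
Qed.

(** Passes from coefficients to values: bounds on [tnorm] become majorants for the series on a whole
    cube. *)
Lemma teval_le k p h (s : R) : homog k p -> (forall i, `|h i| <= s) ->
  `|teval p h| <= tnorm p * s ^+ k.
Proof.
move=> /allP pk hs; rewrite /teval /tnorm mulr_suml.
apply: le_trans (ler_norm_sum _ _ _) _; rewrite !big_seq.
apply: ler_sum => t tp; rewrite normrM ler_wpM2l//.
by rewrite -(eqP (pk _ tp)) monomial_le.
Qed.

Lemma teval_homog0 p h : homog 0 p -> teval p h = teval p (fun=> 0).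
Proof.
move=> /allP p0; rewrite /teval !big_seq; apply: eq_bigr => t /p0.
rewrite sum_nat_eq0 => /forallP t0; congr (_ * _); apply: eq_bigr => i _.
by rewrite (eqP (t0 i)).
Qed.

(** Links unreduced lists to [homogeneous_part]: in degree [k] all exponents are at most [k], so
    each term is collected by exactly one [alpha]. The weight [G] is later the coefficient or its
    absolute value. *)
Lemma sum_monomials (k : nat) p h (G : R * {ffun I -> nat} -> R) : homog k p ->
  \sum_(alpha : {ffun I -> 'I_k.+1} | (\sum_i alpha i == k)%N)
    (\sum_(t <- p | t.2 == [ffun i => nat_of_ord (alpha i)]) G t) *
    \prod_i h i ^+ alpha i = \sum_(t <- p) G t * monomial t.2 h.
Proof.
move=> /allP pk.
under eq_bigr => al alk do rewrite mulr_suml.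
rewrite (exchange_big_dep xpredT)//= !big_seq; apply: eq_bigr => t /pk tk.
have tle i : (t.2 i < k.+1)%N by rewrite ltnS -(eqP tk) (bigD1 i)//= leq_addr.
rewrite (big_pred1 [ffun i => Ordinal (tle i)]); last first.
  move=> al /=; apply/andP/eqP => [[_ /eqP tal]|->].
    by apply/ffunP => i; apply/val_inj; rewrite ffunE/= tal ffunE.
  split; last by apply/eqP/ffunP => i; rewrite !ffunE.
  by rewrite -[X in _ == X](eqP tk); apply/eqP/eq_bigr => i _; rewrite ffunE.
by congr (_ * _); apply: eq_bigr => i _; rewrite ffunE.
Qed.

End Terms.
Arguments terms : clear implicits.

(** * Power series with a uniform coefficient bound *)

Section Expansion.
Context {R : realType} {I : finType}.
Implicit Types (p q : nat -> terms R I) (f g : (I -> R) -> R) (a x : I -> R).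

(** A working form of analyticity: one bound [M] at the radius [s] replaces absolute convergence at
    each point, and the estimates for products and inverses act on it directly. *)
Definition expansion p f a (s M : R) :=
  [/\ forall k, homog k (p k),
      forall N, \sum_(0 <= k < N) tnorm (p k) * s ^+ k <= M &
      forall x, cube a s x ->
        series (fun k => teval (p k) (fun i => x i - a i)) @ \oo --> f x].

Lemma analytic_at_expansion f a : analytic_at f a ->
  exists p s M, 0 < s /\ expansion p f a s M.
Proof.
move=> [c [r [r0 fr]]].
pose p k : terms R I :=
  [seq (c [ffun i => nat_of_ord (al i)], [ffun i => nat_of_ord (al i)])
    | al : {ffun I -> 'I_k.+1} <- index_enum {ffun I -> 'I_k.+1}
    & (\sum_i al i == k)%N].
have pk k : homog k (p k).
  rewrite /homog all_map; apply/allP => al; rewrite mem_filter => /andP[alk _] /=.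
  by rewrite -[X in _ == X](eqP alk); apply/eqP/eq_bigr => i _; rewrite ffunE.
have pE k h : teval (p k) h = homogeneous_part c h k.
  rewrite /teval big_map big_filter/=; apply: eq_bigr => al _ /=.
  by congr (_ * _); apply: eq_bigr => i _; rewrite ffunE.
have nE k (s : R) : homogeneous_part (fun al => `|c al|) (fun=> s) k =
    tnorm (p k) * s ^+ k.
  rewrite /tnorm big_map big_filter/= mulr_suml.
  by apply: eq_bigr => al /eqP alk; rewrite prodrXr alk.
have s0 : 0 < r / 2 by rewrite divr_gt0.
exists p, (r / 2).
(* At this point of the cube every [|x i - a i|] equals [r / 2], so absolute convergence there is
   convergence of the weighted norms, and its limit serves as [M]. *)
have [|+ _] := fr (fun i => a i + r / 2).
  move=> i; rewrite addrAC subrr add0r gtr0_norm//; lra.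
rewrite (_ : (fun i => `|a i + r / 2 - a i|) = fun=> r / 2); last first.
  by apply/funext => i; rewrite addrAC subrr add0r gtr0_norm.
rewrite (funext (fun k => nE k (r / 2))).
set u := series _ => cu; exists (limn u); split=> //; split=> // [N|x xa].
  apply: (nondecreasing_cvgn_le _ cu).
  apply/nondecreasing_seqP => n; rewrite /u /series/= big_nat_recr//= lerDl.
  by rewrite mulr_ge0 ?tnorm_ge0// exprn_ge0// ltW.
have [|_] := fr x; first by move=> i; apply: lt_trans (xa i) _; lra.
rewrite (_ : homogeneous_part c _ = fun k => teval (p k) (fun i => x i - a i))//.
by apply/funext => k; rewrite pE.
Qed.

(** The coefficient at [al] collects the terms with exponent [al]; by the triangle inequality,
    collecting does not increase the sum of absolute values. *)
Lemma expansion_analytic_at p f a s M : 0 < s -> expansion p f a s M ->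
  analytic_at f a.
Proof.
move=> s0 [pk pM pf].
exists (fun al : {ffun I -> nat} => \sum_(t <- p (\sum_i al i)%N | t.2 == al) t.1), s.
split=> // x xa.
have pc k (al : {ffun I -> 'I_k.+1}) : (\sum_i al i)%N = k ->
    p (\sum_i [ffun i => nat_of_ord (al i)] i)%N = p k.
  by move=> alk; congr p; rewrite -[RHS]alk; apply: eq_bigr => i _; rewrite ffunE.
split; last first.
  rewrite (_ : homogeneous_part _ _ = fun k => teval (p k) (fun i => x i - a i)).
    exact: pf.
  apply/funext => k; rewrite -[RHS](sum_monomials _ fst (pk k)).
  by apply: eq_bigr => al /eqP alk; rewrite (pc k).
have hp_ge0 k : 0 <= homogeneous_part (fun al : {ffun I -> nat} =>
    `|\sum_(t <- p (\sum_i al i)%N | t.2 == al) t.1|) (fun i => `|x i - a i|) k.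
  by apply: sumr_ge0 => al _; rewrite mulr_ge0// prodr_ge0// => i _; rewrite exprn_ge0.
apply: (sum_ge0_bounded_cvg (M := M)) => [//|N].
apply: le_trans (pM N); apply: ler_sum => k _.
(* With absolute values as coefficients the norm is unchanged, and evaluation at [|x - a|] is the
   sum to be bounded. *)
pose q : terms R I := [seq (`|t.1|, t.2) | t <- p k].
have qk : homog k q by rewrite /homog all_map; exact: pk.
have -> : tnorm (p k) = tnorm q.
  by rewrite /tnorm big_map; apply: eq_bigr => t _ /=; rewrite normr_id.
apply: le_trans (teval_le (h := fun i => `|x i - a i|) qk _); last first.
  by move=> i; rewrite normr_id ltW// xa.
apply: le_trans (ler_norm _); rewrite /teval big_map.
rewrite -(sum_monomials _ (fun t => `|t.1|) (pk k)).
apply: ler_sum => al /eqP alk; rewrite (pc k)// ler_wpM2r ?ler_norm_sum//.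
by apply: prodr_ge0 => i _; rewrite exprn_ge0.
Qed.

Lemma expansion_shrink p f a s s' M : 0 < s' -> s' <= s ->
  expansion p f a s M -> expansion p f a s' M.
Proof.
move=> s0 ss [pk pM pf]; split=> // [N|x xa].
  apply: le_trans (pM N); apply: ler_sum => k _.
  by rewrite ler_wpM2l ?tnorm_ge0// lerXn2r// nnegrE ltW// (lt_le_trans s0).
by apply: pf => i; exact: lt_le_trans (xa i) ss.
Qed.

End Expansion.

(** * Closure properties of analytic functions *)

Section Closure.
Context {R : realType} {I : finType}.
Implicit Types (p q : nat -> terms R I) (f g : (I -> R) -> R) (a x : I -> R).

Lemma homog_cst (c : R) : homog (R := R) (I := I) 0 [:: (c, [ffun=> 0%N])].
Proof.
by rewrite /homog/= andbT; under eq_bigr do rewrite ffunE; rewrite sum_nat_const muln0.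
Qed.

Lemma teval_cst (c : R) (h : I -> R) : teval [:: (c, [ffun=> 0%N])] h = c.
Proof.
by rewrite /teval big_seq1/= /monomial big1 ?mulr1// => i _; rewrite ffunE.
Qed.

(** The case of polynomials in [x - a]: the partial sums are eventually constant, and at radius 1
    the powers disappear from the bound. *)
Lemma finite_expansion p f a N : (forall k, homog k (p k)) ->
  (forall k, (N <= k)%N -> p k = [::]) ->
  (forall x, \sum_(0 <= k < N) teval (p k) (fun i => x i - a i) = f x) ->
  analytic_at f a.
Proof.
move=> pk pN pf.
have sumN (F : terms R I -> nat -> R) n : (forall k, F [::] k = 0) -> (N <= n)%N ->
    \sum_(0 <= k < n) F (p k) k = \sum_(0 <= k < N) F (p k) k.
  move=> F0 Nn; rewrite (big_cat_nat (n := N))//= [X in _ + X]big_nat_cond.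
  by rewrite [X in _ + X]big1 ?addr0// => k /andP[/andP[/pN-> _] _].
apply: (@expansion_analytic_at _ _ p f a 1 (\sum_(0 <= k < N) tnorm (p k))) => //.
split=> // [n|x _].
  under eq_bigr do rewrite expr1n mulr1.
  apply: le_trans (_ : _ <= \sum_(0 <= k < maxn n N) tnorm (p k)) _.
    rewrite [leRHS](big_cat_nat (n := n)) ?leq_maxl//= lerDl.
    by apply: sumr_ge0 => k _; exact: tnorm_ge0.
  by rewrite (sumN (fun t _ => tnorm t)) ?leq_maxr// => k; rewrite /tnorm big_nil.
apply: cvg_near_cst; exists N => // n /= Nn; rewrite /series/= -pf.
by rewrite (sumN (fun t _ => teval t _))// => k; rewrite /teval big_nil.
Qed.

Lemma analytic_cst c a : analytic_at (fun=> c) a.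
Proof.
pose p k : terms R I := if k is 0 then [:: (c, [ffun=> 0%N])] else [::].
apply: (@finite_expansion p _ _ 1) => [[|k]|[|k]|x]//=.
  exact: (homog_cst c).
by rewrite big_nat1 teval_cst.
Qed.

Lemma analytic_coord (i : I) a : analytic_at (fun x => x i) a.
Proof.
pose p k : terms R I := match k with
  | 0 => [:: (a i, [ffun=> 0%N])]
  | 1 => [:: (1, [ffun j => nat_of_bool (j == i)])]
  | _ => [::] end.
apply: (@finite_expansion p _ _ 2) => [[|[|k]]|[|[|k]]|x]//=.
- exact: (homog_cst (a i)).
- rewrite /homog/= andbT; under eq_bigr do rewrite ffunE.
  by rewrite (bigD1 i)//= eqxx big1 // => j /negPf ->.
rewrite big_nat_recr//= big_nat1 teval_cst /teval !big_seq1/= /monomial.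
rewrite (bigD1 i)//= big1 ?ffunE ?eqxx ?mulr1 ?mul1r ?expr1 ?subrKC// => j /negPf ji.
by rewrite ffunE ji expr0.
Qed.

Lemma analytic_ext f g a : f =1 g -> analytic_at f a -> analytic_at g a.
Proof. by move=> /funext ->. Qed.

Lemma analytic_add f g a : analytic_at f a -> analytic_at g a ->
  analytic_at (fun x => f x + g x) a.
Proof.
move=> /analytic_at_expansion[p [s [M [s0 fp]]]].
move=> /analytic_at_expansion[q [s' [M' [s0' gq]]]].
have r0 : 0 < Num.min s s' by rewrite lt_min s0.
have [rs rs'] : Num.min s s' <= s /\ Num.min s s' <= s' by rewrite !ge_min !lexx orbT.
have [pk pM pf] := expansion_shrink r0 rs fp.
have [qk qM qg] := expansion_shrink r0 rs' gq.
apply: (@expansion_analytic_at _ _ (fun k => p k ++ q k) _ _ _ (M + M') r0).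
split=> [k|N|x xa].
- by rewrite /homog all_cat; apply/andP; split; [exact: pk|exact: qk].
- under eq_bigr do rewrite tnorm_cat mulrDl.
  by rewrite big_split lerD.
- rewrite (_ : series _ = series (fun k => teval (p k) (fun i => x i - a i)) \+
      series (fun k => teval (q k) (fun i => x i - a i))).
    by apply: cvgD; [exact: pf|exact: qg].
  apply/funext => n; rewrite /series/= -big_split.
  by apply: eq_bigr => k _; rewrite teval_cat.
Qed.

Definition tcauchy p q k : terms R I :=
  flatten [seq tmul (p i) (q (k - i)%N) | i <- index_iota 0 k.+1].

Lemma homog_flatten (k : nat) (T : eqType) (r : seq T) (F : T -> terms R I) :
  (forall i, i \in r -> homog k (F i)) -> homog k (flatten [seq F i | i <- r]).
Proof.
move=> Fk; apply/allP => t /flatten_mapP[i /Fk/allP]; exact.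
Qed.

Lemma teval_flatten T (r : seq T) (F : T -> terms R I) h :
  teval (flatten [seq F i | i <- r]) h = \sum_(i <- r) teval (F i) h.
Proof. by rewrite /teval big_flatten big_map. Qed.

Lemma tnorm_flatten T (r : seq T) (F : T -> terms R I) :
  tnorm (flatten [seq F i | i <- r]) = \sum_(i <- r) tnorm (F i).
Proof. by rewrite /tnorm big_flatten big_map. Qed.

(** Since [tnorm] is multiplicative, the norms of [tcauchy] are the Cauchy product of the norms,
    whence the bound [M * M']; the value comes from [cvg_cauchy_product]. *)
Lemma analytic_mul f g a : analytic_at f a -> analytic_at g a ->
  analytic_at (fun x => f x * g x) a.
Proof.
move=> /analytic_at_expansion[p [s [M [s0 fp]]]].
move=> /analytic_at_expansion[q [s' [M' [s0' gq]]]].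
have r0 : 0 < Num.min s s' by rewrite lt_min s0.
have [rs rs'] : Num.min s s' <= s /\ Num.min s s' <= s' by rewrite !ge_min !lexx orbT.
have [pk pM pf] := expansion_shrink r0 rs fp.
have [qk qM qg] := expansion_shrink r0 rs' gq.
set r := Num.min s s' in r0 rs rs' pM qM pf qg.
have n0 (u : nat -> terms R I) k : 0 <= tnorm (u k) * r ^+ k.
  by rewrite mulr_ge0 ?tnorm_ge0// exprn_ge0// ltW.
apply: (@expansion_analytic_at _ _ (tcauchy p q) _ _ _ (M * M') r0).
split=> [k|N|x xa].
- apply: homog_flatten => i; rewrite mem_index_iota ltnS => /= ik.
  by have := homog_mul (pk i) (qk (k - i)%N); rewrite subnKC.
- apply: le_trans (_ : _ <= (\sum_(0 <= k < N) tnorm (p k) * r ^+ k) *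
      (\sum_(0 <= k < N) tnorm (q k) * r ^+ k)) _; last first.
    by apply: ler_pM => //; apply: sumr_ge0.
  apply: le_trans (ler_sum_triangle _ (n0 p) (n0 q)).
  apply: ler_sum => k _; rewrite tnorm_flatten mulr_suml.
  rewrite ler_sum_nat// => i /andP[_]; rewrite ltnS => ik.
  by rewrite tnorm_mul mulrACA -exprD subnKC.
- have le_r (u : nat -> terms R I) k : homog k (u k) ->
      `|teval (u k) (fun i => x i - a i)| <= tnorm (u k) * r ^+ k.
    by move=> uk; apply: teval_le => // i; exact/ltW/xa.
  rewrite (_ : (fun k => _) = fun k => \sum_(0 <= i < k.+1)
      teval (p i) (fun i => x i - a i) * teval (q (k - i)%N) (fun i => x i - a i)).
    by apply: (cvg_cauchy_product (fun k => le_r p k (pk k))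
      (fun k => le_r q k (qk k)) pM qM); [exact: pf|exact: qg].
  apply/funext => k; rewrite teval_flatten.
  by apply: eq_bigr => i _; rewrite teval_mul.
Qed.

(** Iterating [F] from a constant sequence, the entries below [n] are final after [n] steps; the
    solution is read off the diagonal. *)
Lemma strong_recursion T (t0 : T) (F : (nat -> T) -> nat -> T) :
  (forall u v k, (forall i, (i < k)%N -> u i = v i) -> F u k = F v k) ->
  exists u, forall k, u k = F u k.
Proof.
move=> Fext; pose w n := iter n F (fun=> t0).
have wE k : forall m n, (k < m)%N -> (k < n)%N -> w m k = w n k.
  elim/ltn_ind: k => k IH [|m] [|n]// km kn.
  by apply: Fext => i ik; apply: IH => //; exact: leq_trans ik _.
exists (fun k => w k.+1 k) => k; apply: Fext => i ik.
by apply: wE.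
Qed.

Lemma analytic_inv f a : f a != 0 -> analytic_at f a ->
  analytic_at (fun x => (f x)^-1) a.
Proof.
move=> fa0 /analytic_at_expansion[p [s [M [s0 [pk pM pf]]]]].
have pa0 k : teval (p k.+1) (fun i => a i - a i) = 0.
  apply/eqP; rewrite -normr_le0 (le_trans (teval_le (s := 0) (pk _) _))//.
    by move=> i; rewrite subrr normr0.
  by rewrite expr0n mulr0.
(* At [x = a] only the degree-0 part survives, and that part is constant. *)
have p0 h : teval (p 0%N) h = f a.
  have sa : cube a s a by move=> i; rewrite subrr normr0.
  rewrite (teval_homog0 _ (pk _)); symmetry; apply: (cvg_unique _ (pf _ sa)) => //.
  apply: cvg_near_cst; exists 1%N => // -[//|n] _.
  rewrite /series/= big_nat_recl//= big1 ?addr0; last by move=> i _; exact: pa0.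
  exact: teval_homog0.
(* Solves the equation [p * q = 1] degree by degree: the degree [k] part is [f a] times [q k] plus
   terms in earlier entries of [q]. *)
pose Q q k : terms R I := if k is k'.+1
  then flatten [seq tscale (- (f a)^-1) (tmul (p i.+1) (q (k' - i)%N))
               | i <- index_iota 0 k]
  else [:: ((f a)^-1, [ffun=> 0%N])].
have [|q qE] := @strong_recursion (terms R I) [::] Q.
  move=> u v [//|k] uv; congr flatten; apply/eq_in_map => i _.
  by rewrite uv// ltnS leq_subr.
have qk k : homog k (q k).
  elim/ltn_ind: k => -[_|k IH]; rewrite qE.
    exact: (homog_cst (f a)^-1).
  apply: homog_flatten => i; rewrite mem_index_iota ltnS => /= ik; apply: homog_scale.
  have ki : (k - i < k.+1)%N by rewrite ltnS leq_subr.
  by have := homog_mul (pk i.+1) (IH _ ki); rewrite addSn subnKC.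
have M0 : 0 <= M by apply: le_trans (pM 0%N); rewrite big_nil.
pose m := `|f a|; have m0 : 0 < m by rewrite normr_gt0.
have d0 : 0 < 2 * M + m by lra.
(* The radius is reduced so that the nonconstant part of [f] is at most half of
   its constant term. *)
pose t := m / (2 * M + m).
have t0 : 0 < t by rewrite divr_gt0.
have t1 : t <= 1 by rewrite ler_pdivrMr// mul1r; lra.
have tM : t * M <= m / 2.
  rewrite /t mulrAC ler_pdivrMr//.
  rewrite -mulrA ler_wpM2l ?(ltW m0)//; lra.
pose r := t * s.
have r0 : 0 < r by rewrite mulr_gt0.
have rs : r <= s by rewrite ger_pMl.
have n0 (u : nat -> terms R I) k : 0 <= tnorm (u k) * r ^+ k.
  by rewrite mulr_ge0 ?tnorm_ge0// exprn_ge0// ltW.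
have [_ pM' pf'] := expansion_shrink r0 rs (And3 pk pM pf).
(* Each term of positive degree gains a factor [t ^+ k.+1 <= t] over radius [s], so the tail is at
   most [t * M]. *)
have ptail N : \sum_(0 <= k < N) tnorm (p k.+1) * r ^+ k.+1 <= m / 2.
  apply: le_trans tM; apply: le_trans (ler_wpM2l (ltW t0) (pM N.+1)).
  rewrite big_nat_recl// mulrDr mulr_sumr -[leLHS]add0r lerD//.
    by rewrite mulr_ge0 ?(ltW t0)// mulr_ge0 ?tnorm_ge0// exprn_ge0// ltW.
  apply: ler_sum => k _; rewrite mulrCA ler_wpM2l ?tnorm_ge0//.
  rewrite exprMn ler_wpM2r ?exprn_ge0 ?(ltW s0)//.
  by rewrite exprS ger_pMr// exprn_ile1// ltW.
(* The recursion bounds the next partial sum by [m^-1 + m^-1 * (m / 2) * S], where [S] is the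
   current one; [2 / m] is the fixed point of this map. *)
have qM N : \sum_(0 <= k < N) tnorm (q k) * r ^+ k <= 2 / m.
  elim: N => [|N IH]; first by rewrite big_nil divr_ge0// ltW.
  rewrite big_nat_recl// qE/= /tnorm big_seq1/= mulr1 normfV -/m.
  rewrite (_ : 2 / m = m^-1 + m^-1 * (m / 2 * (2 / m))); last by field; lra.
  rewrite lerD2l.
  apply: le_trans (_ : _ <= m^-1 * (\sum_(0 <= k < N) \sum_(0 <= i < k.+1)
      (tnorm (p i.+1) * r ^+ i.+1) * (tnorm (q (k - i)%N) * r ^+ (k - i)))) _.
    rewrite mulr_sumr; apply: ler_sum => k _; rewrite qE -/(tnorm _) tnorm_flatten.
    rewrite mulr_suml mulr_sumr ler_sum_nat// => i /andP[_].
    rewrite ltnS => ik; rewrite tnorm_scale tnorm_mul normrN normfV -/m.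
    by rewrite mulrACA -exprD addSn subnKC// !mulrA.
  rewrite ler_wpM2l ?invr_ge0 ?(ltW m0)//.
  apply: le_trans (ler_sum_triangle _ (fun k => n0 p k.+1) (n0 q)) _.
  by apply: ler_pM (ptail N) IH; apply: sumr_ge0 => k _; [exact: n0 p k.+1|exact: n0 q k].
apply: (@expansion_analytic_at _ _ q _ _ _ (2 / m) r0); split=> // x xa.
have le_r (u : nat -> terms R I) k : homog k (u k) ->
    `|teval (u k) (fun i => x i - a i)| <= tnorm (u k) * r ^+ k.
  by move=> uk; apply: teval_le => // i; exact/ltW/xa.
have /cvg_ex[l ql] := dominated_cvg_series (fun k => le_r q k (qk k)) qM.
have := cvg_cauchy_product (fun k => le_r p k (pk k)) (fun k => le_r q k (qk k))
  pM' qM (pf' x xa) ql.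
set c := (fun k : nat => _) => /(cvg_unique _) fl.
have {}fl : f x * l = 1.
  (* From index 1 on the partial sums equal 1: degree 0 gives [f a * (f a)^-1], and the recursion
     cancels every higher degree. *)
  apply: fl => //; apply: cvg_near_cst; exists 1%N => // -[//|n] _.
  rewrite /series/= big_nat_recl//= big1 ?addr0 => [|k _].
    by rewrite /c big_nat1 p0 qE teval_cst mulfV.
  rewrite /c big_nat_recl//= p0 subn0 qE teval_flatten mulr_sumr -big_split.
  apply: big1 => i _ /=; rewrite teval_scale teval_mul subSS.
  by rewrite mulrA mulrN mulfV// mulN1r addNr.
rewrite (_ : (f x)^-1 = l)//.
have fx0 : f x != 0 by apply: contra_eq_neq fl => ->; rewrite mul0r eq_sym oner_eq0.
by rewrite -[LHS]mulr1 -fl mulKf.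
Qed.

Lemma analytic_sum T (r : seq T) (P : pred T) (F : T -> (I -> R) -> R) a :
  (forall t, analytic_at (F t) a) -> analytic_at (fun x => \sum_(t <- r | P t) F t x) a.
Proof.
move=> Fa; elim: r => [|t r IH].
  by apply: analytic_ext (analytic_cst 0 a) => x; rewrite big_nil.
have [Pt|nPt] := boolP (P t).
  by apply: analytic_ext (analytic_add (Fa t) IH) => x; rewrite big_cons Pt.
by apply: analytic_ext IH => x; rewrite big_cons (negPf nPt).
Qed.

End Closure.

(** * Elimination with the first pivot *)

Section SchurRecursion.
Context {R : realType}.

Definition schur n (A : 'M[R]_(1 + n)) : 'M[R]_n :=
  drsubmx A - (A 0 0)^-1 *: (dlsubmx A *m ursubmx A).

(** The candidate inverse of [LDU_mul], defined on all matrices because a zero pivot has inverse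
    0. *)
Fixpoint LDU_of n : 'M[R]_n -> 'M[R]_n * 'M[R]_n * 'M[R]_n :=
  match n return 'M[R]_n -> 'M[R]_n * 'M[R]_n * 'M[R]_n with
  | 0 => fun=> (1%:M, 1%:M, 1%:M)
  | n'.+1 => fun A : 'M[R]_(1 + n') =>
      let p := LDU_of (schur A) in
      ((block_mx 1%:M 0 ((A 0 0)^-1 *: dlsubmx A) p.1.1 : 'M[R]_(1 + n')),
       (block_mx (A 0 0)%:M 0 0 p.1.2 : 'M[R]_(1 + n')),
       (block_mx 1%:M ((A 0 0)^-1 *: ursubmx A) 0 p.2 : 'M[R]_(1 + n')))
  end.

Lemma block_mx_pivot n (A : 'M[R]_(1 + n)) :
  A = block_mx (A 0 0)%:M (ursubmx A) (dlsubmx A) (drsubmx A).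
Proof.
rewrite -{1}(submxK A); congr block_mx; rewrite [LHS]mx11_scalar !mxE.
by congr (A _ _)%:M; apply/val_inj.
Qed.

Lemma block_mx00 n (a : R) (r : 'rV[R]_n) (c : 'cV[R]_n) (B : 'M[R]_n) :
  block_mx a%:M r c B 0 0 = a.
Proof.
by rewrite (_ : 0 = lshift n (0 : 'I_1)) ?block_mxEul ?mxE ?eqxx//; apply/val_inj.
Qed.

Lemma schur_block n (a : R) (r : 'rV[R]_n) (c : 'cV[R]_n) (B : 'M[R]_n) :
  schur (block_mx a%:M r c B) = B - a^-1 *: (c *m r).
Proof. by rewrite /schur block_mx00 block_mxKdr block_mxKdl block_mxKur. Qed.

(** One elimination step writes [A] as a unit lower block triangular matrix times an upper one with
    the pivot and [schur A] on the diagonal. *)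
Lemma det_schur n (A : 'M[R]_(1 + n)) : A 0 0 != 0 ->
  \det A = A 0 0 * \det (schur A).
Proof.
move=> a0; rewrite {1}(_ : A = block_mx 1%:M 0 ((A 0 0)^-1 *: dlsubmx A) 1%:M *m
    block_mx (A 0 0)%:M (ursubmx A) 0 (schur A)).
  by rewrite det_mulmx det_lblock det_ublock !det1 !mul1r det_scalar1.
rewrite {1}[A]block_mx_pivot mulmx_block !(mul1mx, mul0mx, addr0).
by rewrite mul_mx_scalar scalerA mulfV// scale1r -scalemxAl subrKC.
Qed.

(** An entry of the Schur complement involves only the pivot, its own position and the first row and
    column, so truncation commutes with elimination. *)
Lemma leading_minor_schur n (A : 'M[R]_(1 + n)) j (jn : (j <= n)%N)
    (jn' : (j.+1 <= n.+1)%N) :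
  leading_minor (schur A) jn = schur (leading_minor A jn' : 'M[R]_(1 + j)).
Proof.
have E k (kn : (k.+1 <= n.+1)%N) : widen_ord kn ord0 = 0 by apply/val_inj.
have El (i : 'I_1) : widen_ord jn' (lshift j i) = lshift n i by apply/val_inj.
have Er i : widen_ord jn' (rshift 1 i) = rshift 1 (widen_ord jn i) by apply/val_inj.
apply/matrixP => i k; rewrite !mxE !E !Er; congr (_ - _ * _).
by apply: eq_bigr => l _; rewrite !mxE !Er !El.
Qed.

Lemma leading_minor00 n (A : 'M[R]_(1 + n)) j (jn : (j.+1 <= n.+1)%N) :
  leading_minor A jn 0 0 = A 0 0.
Proof. by rewrite mxE; congr (A _ _); apply/val_inj. Qed.

(** By [det_schur], the block of size [j.+1] of [A] is invertible exactly when the pivot and the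
    block of size [j] of [schur A] are. *)
Lemma minors_invertible_schur n (A : 'M[R]_(1 + n)) :
  minors_invertible A <-> A 0 0 != 0 /\ minors_invertible (schur A).
Proof.
split=> [PA|[a0 PS] [//|j] jn _].
  have a0 : A 0 0 != 0.
    have := PA 1%N isT isT.
    by rewrite unitmxE det_mx11 leading_minor00 unitfE.
  split=> // j jn _; have := PA j.+1 jn isT.
  rewrite (leading_minor_schur _ _ (jn : (j.+1 <= n.+1)%N)) !unitmxE !unitfE.
  by rewrite (@det_schur j) leading_minor00// mulf_eq0 negb_or => /andP[].
rewrite unitmxE (@det_schur j) leading_minor00// unitfE mulf_neq0//.
rewrite -(leading_minor_schur _ (jn : (j <= n)%N)) -unitfE -unitmxE.
(* For the 1 x 1 block of [A] the Schur complement is empty, with determinant 1; [PS] covers only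
   positive sizes. *)
case: j jn => [|j] jn; last exact: PS.
by rewrite unitmxE det_mx00 unitr1.
Qed.

(** * Bordered factors and the inverse of the product map *)

Lemma unit_lower_block n (c : 'cV[R]_n) (L : 'M[R]_n) :
  unit_lower (block_mx 1%:M 0 c L : 'M[R]_(1 + n)) <-> unit_lower L.
Proof.
rewrite /unit_lower/= is_trig_block_mx// eqxx scalar_mx_is_trig/=.
split=> -[tL dL]; split=> // i.
  by have := dL (rshift 1 i); rewrite block_mxEdr.
by case: (split_ordP i) => k ->; rewrite ?block_mxEul ?block_mxEdr// mxE eqxx.
Qed.

Lemma unit_lower_blockE n (L : 'M[R]_(1 + n)) : unit_lower L ->
  L = block_mx 1%:M 0 (dlsubmx L) (drsubmx L).
Proof.
move=> [tL dL]; rewrite {1}[L]block_mx_pivot dL.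
move: tL; rewrite {1}[L]block_mx_pivot is_trig_block_mx// => /and3P[/eqP-> _ _].
by [].
Qed.

Lemma unit_upper_tr n (U : 'M[R]_n) : unit_upper U <-> unit_lower U^T.
Proof. by split=> -[tU dU]; split=> // i; have := dU i; rewrite mxE. Qed.

Lemma unit_upper_block n (r : 'rV[R]_n) (U : 'M[R]_n) :
  unit_upper (block_mx 1%:M r 0 U : 'M[R]_(1 + n)) <-> unit_upper U.
Proof. by rewrite !unit_upper_tr tr_block_mx trmx1 trmx0 unit_lower_block. Qed.

Lemma unit_upper_blockE n (U : 'M[R]_(1 + n)) : unit_upper U ->
  U = block_mx 1%:M (ursubmx U) 0 (drsubmx U).
Proof.
move=> /unit_upper_tr /unit_lower_blockE /(congr1 trmx).
by rewrite tr_block_mx trmx1 trmx0 trmx_dlsub trmx_drsub !trmxK.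
Qed.

Lemma invertible_diag_block n (a : R) (D : 'M[R]_n) :
  invertible_diag (block_mx a%:M 0 0 D : 'M[R]_(1 + n)) <-> a != 0 /\ invertible_diag D.
Proof.
rewrite /invertible_diag/= is_diag_block_mx// eqxx scalar_mx_is_diag/= eqxx/=.
rewrite !unitmxE det_ublock det_scalar1 unitrM unitfE.
by split=> [[-> /andP[-> ->]]|[-> [-> ->]]].
Qed.

Lemma invertible_diag_blockE n (D : 'M[R]_(1 + n)) : invertible_diag D ->
  D = block_mx (D 0 0)%:M 0 0 (drsubmx D).
Proof.
move=> [+ _]; rewrite {1}[D]block_mx_pivot is_diag_block_mx//.
move=> /and4P[/eqP r0 /eqP c0 _ _].
by rewrite {1}[D]block_mx_pivot r0 c0.
Qed.

(** The summand [a *: (c *m r)] is exactly what elimination subtracts, so the Schur complement of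
    the product is the product of the inner factors. *)
Lemma LDU_mul_block n (a : R) (c : 'cV[R]_n) (r : 'rV[R]_n) (L D U : 'M[R]_n) :
  LDU_mul (block_mx 1%:M 0 c L, block_mx a%:M 0 0 D, block_mx 1%:M r 0 U) =
  block_mx a%:M (a *: r) (a *: c) (a *: (c *m r) + LDU_mul (L, D, U)).
Proof.
rewrite /LDU_mul/= !mulmx_block !(mul1mx, mul0mx, mulmx0, addr0, add0r, mulmx1).
by rewrite mul_mx_scalar mul_scalar_mx -scalemxAl.
Qed.

(** Every triple arises by bordering a smaller one, which permits induction on the size. *)
Lemma LDU_domS n (p : 'M[R]_(1 + n) * 'M[R]_(1 + n) * 'M[R]_(1 + n)) :
  LDU_dom p -> exists (a : R) (c : 'cV[R]_n) (r : 'rV[R]_n) q, [/\ a != 0, LDU_dom q &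
    p = (block_mx 1%:M 0 c q.1.1, block_mx a%:M 0 0 q.1.2, block_mx 1%:M r 0 q.2)].
Proof.
case: p => [[L D] U] [[/= hL hD] hU].
move: (hL) (hD) (hU); rewrite (unit_lower_blockE hL) (invertible_diag_blockE hD).
rewrite (unit_upper_blockE hU).
move=> /unit_lower_block L1 /invertible_diag_block[a0 D1] /unit_upper_block U1.
by exists (D 0 0), (dlsubmx L), (ursubmx U), (drsubmx L, drsubmx D, drsubmx U).
Qed.

Lemma LDU_mul_minors n (p : 'M[R]_n * 'M[R]_n * 'M[R]_n) :
  LDU_dom p -> minors_invertible (LDU_mul p).
Proof.
elim: n p => [|n IH] p; first by move=> _ [//|j] [].
move=> /LDU_domS[a [c [r [q [a0 Dq ->]]]]].
apply/minors_invertible_schur; rewrite LDU_mul_block block_mx00; split=> //.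
rewrite schur_block -scalemxAl -scalemxAr !scalerA mulVf// mul1r.
by rewrite addrAC subrr add0r -!surjective_pairing; exact: IH.
Qed.

Lemma LDU_mulK n (p : 'M[R]_n * 'M[R]_n * 'M[R]_n) :
  LDU_dom p -> LDU_of (LDU_mul p) = p.
Proof.
elim: n p => [|n IH] p.
  by case: p => [[L D] U] _; congr (_, _, _); apply/matrixP => -[].
move=> /LDU_domS[a [c [r [q [a0 Dq ->]]]]]; rewrite LDU_mul_block /=.
rewrite block_mx00 block_mxKdl block_mxKur !scalerA mulVf// !scale1r.
rewrite schur_block -scalemxAl -scalemxAr !scalerA mulVf// mul1r.
by rewrite addrAC subrr add0r -!surjective_pairing IH.
Qed.

Lemma LDU_of_dom n (A : 'M[R]_n) : minors_invertible A -> LDU_dom (LDU_of A).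
Proof.
elim: n A => [|n IH] A.
  move=> _; split; first (split; split) => /=; rewrite ?unitmx1 ?scalar_mx_is_trig//.
  - by case.
  - by split=> [|[]//]; rewrite trmx1 scalar_mx_is_trig.
move=> /minors_invertible_schur[a0 /IH[[/= hL hD] hU]].
split; first split => /=.
- exact/unit_lower_block.
- exact/invertible_diag_block.
- exact/unit_upper_block.
Qed.

Lemma LDU_ofK n (A : 'M[R]_n) : minors_invertible A -> LDU_mul (LDU_of A) = A.
Proof.
elim: n A => [|n IH] A; first by move=> _; apply/matrixP => -[].
move=> /minors_invertible_schur[a0 /IH SE].
rewrite [LDU_of A]/= LDU_mul_block -!surjective_pairing SE !scalerA mulfV// !scale1r.
rewrite -scalemxAl -scalemxAr !scalerA mulfV// mul1r.
by rewrite subrKC -block_mx_pivot.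
Qed.

(** * Analytic dependence of the factors *)

Section Analytic.
Variable I : finType.

Definition analytic_mx m n (A : (I -> R) -> 'M[R]_(m, n)) x :=
  forall i j, analytic_at (fun y => A y i j) x.

Lemma analytic_block_mx m1 m2 n1 n2 (A : (I -> R) -> 'M[R]_(m1, n1))
    (B : (I -> R) -> 'M[R]_(m1, n2)) (C : (I -> R) -> 'M[R]_(m2, n1))
    (D : (I -> R) -> 'M[R]_(m2, n2)) x :
  analytic_mx A x -> analytic_mx B x -> analytic_mx C x -> analytic_mx D x ->
  analytic_mx (fun y => block_mx (A y) (B y) (C y) (D y)) x.
Proof.
move=> anA anB anC anD i j.
case: (split_ordP i) => k ->; case: (split_ordP j) => l ->.
- by apply: analytic_ext (anA k l) => y; rewrite block_mxEul.
- by apply: analytic_ext (anB k l) => y; rewrite block_mxEur.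
- by apply: analytic_ext (anC k l) => y; rewrite block_mxEdl.
- by apply: analytic_ext (anD k l) => y; rewrite block_mxEdr.
Qed.

Lemma analytic_mulmx m n k (A : (I -> R) -> 'M[R]_(m, n))
    (B : (I -> R) -> 'M[R]_(n, k)) x :
  analytic_mx A x -> analytic_mx B x -> analytic_mx (fun y => A y *m B y) x.
Proof.
move=> anA anB i j; have := analytic_sum (index_enum 'I_n) xpredT
  (fun l => analytic_mul (anA i l) (anB l j)).
by apply: analytic_ext => y; rewrite mxE.
Qed.

(** Stated for a matrix depending on parameters, so that the induction hypothesis applies to
    [schur (A y)] over the same parameter space. A nonzero pivot at [x] is enough for
    [analytic_inv]. *)
Lemma LDU_of_analytic n (A : (I -> R) -> 'M[R]_n) x :
  analytic_mx A x -> minors_invertible (A x) ->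
  [/\ analytic_mx (fun y => (LDU_of (A y)).1.1) x,
    analytic_mx (fun y => (LDU_of (A y)).1.2) x &
    analytic_mx (fun y => (LDU_of (A y)).2) x].
Proof.
elim: n A => [|n IH] A anA; first by split=> -[].
move=> /minors_invertible_schur[a0 PS].
have anV : analytic_at (fun y => (A y 0 0)^-1) x by exact: analytic_inv.
have anS : analytic_mx (fun y => schur (A y)) x.
  have anM := @analytic_mulmx n 1 n (fun y => dlsubmx (A y : 'M[R]_(1 + n)))
    (fun y => ursubmx (A y : 'M[R]_(1 + n))) x.
  move=> i j; apply: (analytic_ext (f := fun y => A y (rshift 1 i) (rshift 1 j) +
      (-1) * ((A y 0 0)^-1 * (dlsubmx (A y : 'M[R]_(1 + n)) *m
                              ursubmx (A y : 'M[R]_(1 + n))) i j))).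
    by move=> y; rewrite mulN1r !mxE.
  apply: analytic_add => //; apply: analytic_mul; first exact: analytic_cst.
  apply: analytic_mul => //; apply: anM => k l.
    by apply: (analytic_ext _ (anA (rshift 1 k) (lshift n l))) => y; rewrite !mxE.
  by apply: (analytic_ext _ (anA (lshift n k) (rshift 1 l))) => y; rewrite !mxE.
have [anL anD anU] := IH _ anS PS.
have anc m k (B : 'M[R]_(m, k)) : analytic_mx (fun=> B) x.
  by move=> i j; exact: analytic_cst.
split; rewrite /=.
- apply: (@analytic_block_mx 1 n 1 n) => // k l.
  apply: (analytic_ext _ (analytic_mul anV (anA (rshift 1 k) (lshift n l)))) => y.
  by rewrite !mxE.
- apply: (@analytic_block_mx 1 n 1 n) => // k l.
  by apply: (analytic_ext _ (anA 0 0)) => y; rewrite !ord1 mxE eqxx.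
- apply: (@analytic_block_mx 1 n 1 n) => // k l.
  apply: (analytic_ext _ (analytic_mul anV (anA (lshift n k) (rshift 1 l)))) => y.
  by rewrite !mxE.
Qed.

(** The map [e] places the free entries among the coordinates of a larger space, as needed for each
    factor of the product chart. *)
Lemma mx_param_analytic n (Q : pred ('I_n * 'I_n)) (B : 'M[R]_n)
    (e : {ij | Q ij} -> I) (a : I -> R) :
  analytic_mx (fun x => mx_param B (fun s => x (e s))) a.
Proof.
move=> i j.
have [s _ sE|nQ] := insubP {ij | Q ij} (i, j).
  apply: (analytic_ext _ (analytic_coord (e s) a)) => x.
  by rewrite mxE -sE valK.
by apply: (analytic_ext _ (analytic_cst (B i j) a)) => x; rewrite mxE insubN.
Qed.

End Analytic.

End SchurRecursion.

(** * The diffeomorphism and the unique factorization *)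

Theorem theorem3 (R : realType) (n : nat) (n_gt0 : (0 < n)%N) :
  analytic_diffeomorphism (LDU_chart R n) (minors_chart R n) (@LDU_mul R n) /\
  (forall A : 'M[R]_n, minors_invertible A ->
     exists! p : 'M[R]_n * 'M[R]_n * 'M[R]_n, LDU_factorization A p).
Proof.
split; last first.
  move=> A PA; exists (LDU_of A); split.
    by split; [exact: LDU_of_dom|rewrite LDU_ofK].
  by move=> p [Dp ->]; rewrite LDU_mulK.
split.
- split=> [p|p q /set_mem Dp /set_mem Dq pq|A PA]; first exact: LDU_mul_minors.
    by rewrite -(LDU_mulK Dp) pq LDU_mulK.
  by exists (LDU_of A); [exact: LDU_of_dom|exact: LDU_ofK].
- split=> [p|p Dp [[i j] ?]]; first exact: LDU_mul_minors.
  (* In coordinates, the entries of the product are sums of products of chart coordinates and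
     constants. *)
  rewrite /minors_chart /mx_chart /= /mx_coords/= /LDU_mul/=.
  by do !apply: analytic_mulmx; exact: mx_param_analytic.
- exists (@LDU_of R n); split; [exact: LDU_mulK|exact: LDU_ofK|].
  split=> [A|A PA]; first exact: LDU_of_dom.
  have PA' : minors_invertible (param (minors_chart R n) (coords (minors_chart R n) A)).
    by rewrite coordsK.
  have [anL anD anU] := LDU_of_analytic
    (mx_param_analytic 0 id (coords (minors_chart R n) A)) PA'.
  (* A coordinate of the product chart is a free entry of [L], [D] or [U]. *)
  by move=> [[[[i j] ?]|[[i j] ?]]|[[i j] ?]]; [exact: anL|exact: anD|exact: anU].
Qed.
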